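(* Let $M\in\mathbb{R}^{n\times n}$ be symmetric positive definite and $1\le p\le n$. The mapping $\mathcal{T}$ defined, for $X\in\mathrm{St}_M(n,p)$ and $Z\in T_X\mathrm{St}_M(n,p)$, by $$\mathcal{T}_Z: T_X\mathrm{St}_M(n,p)\to T_{\mathcal{R}_X(Z)}\mathrm{St}_M(n,p),\qquad \mathcal{T}_Z(Y)=\Big(I-\tfrac12W_ZM\Big)^{-1}\Big(I+\tfrac12W_ZM\Big)Y,$$ is a vector transport on $\mathrm{St}_M(n,p)$ (with associated retraction the Cayley retraction $\mathcal{R}$). Moreover, it is isometric with respect to the metric $\langle\xi,\eta\rangle_X=\operatorname{tr}(\xi^\top M\eta)$, i.e. $\langle\mathcal{T}_Z(Y),\mathcal{T}_Z(Y)\rangle_{\mathcal{R}_X(Z)}=\langle Y,Y\rangle_X$ for all $X\in\mathrm{St}_M(n,p)$ and $Y,Z\in T_X\mathrm{St}_M(n,p)$.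
   Context: $\mathrm{St}_M=\mathrm{St}_M(n,p)=\{X\in\mathbb{R}^{n\times p}: X^\top MX=I_p\}$, $T_X\mathrm{St}_M=\{Z\in\mathbb{R}^{n\times p}:X^\top MZ+Z^\top MX=0\}$, with Riemannian metric $\langle\xi,\eta\rangle_X=\operatorname{tr}(\xi^\top M\eta)$. For $X\in\mathrm{St}_M$, $Z\in T_X\mathrm{St}_M$: $P_X=I-\tfrac12XX^\top M$, $W_Z=P_XZX^\top-XZ^\top P_X^\top$ (skew-symmetric), and the Cayley retraction is $\mathcal{R}_X(Z)=(I-\tfrac12W_ZM)^{-1}(I+\tfrac12W_ZM)X$. A retraction on $\mathrm{St}_M$ is a smooth map $\mathcal{R}:T\mathrm{St}_M\to\mathrm{St}_M$ whose restrictions $\mathcal{R}_X$ to $T_X\mathrm{St}_M$ satisfy $\mathcal{R}_X(0_X)=X$ and $\mathrm{D}\mathcal{R}_X(0_X)=\mathrm{id}_{T_X\mathrm{St}_M}$. A vector transport on $\mathrm{St}_M$ is a smooth map $T\mathrm{St}_M\oplus T\mathrm{St}_M\to T\mathrm{St}_M$, $(\eta,\xi)\mapsto\mathcal{T}_\eta(\xi)$, where $T\mathrm{St}_M\oplus T\mathrm{St}_M=\{(\eta,\xi):\eta,\xi\in T_X\mathrm{St}_M,\ X\in\mathrm{St}_M\}$, such that: (1) there is a retraction $\mathcal{R}$ (the associated retraction) with $\mathcal{T}_\eta(\xi)\in T_{\mathcal{R}_X(\eta)}\mathrm{St}_M$ for all $\eta,\xi\in T_X\mathrm{St}_M$; (2)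 $\mathcal{T}_{0_X}(\xi)=\xi$ for all $\xi\in T_X\mathrm{St}_M$; (3) $\mathcal{T}_\eta(a\xi+b\zeta)=a\mathcal{T}_\eta(\xi)+b\mathcal{T}_\eta(\zeta)$ for all $a,b\in\mathbb{R}$ and $\eta,\xi,\zeta\in T_X\mathrm{St}_M$. *)

(* Defs.v *)
From HB Require Import structures.
From mathcomp Require Import all_boot all_order all_algebra.
From mathcomp Require Import all_classical all_reals all_analysis.

Set Implicit Arguments.
Unset Strict Implicit.
Unset Printing Implicit Defensive.

Import Order.TTheory GRing.Theory Num.Theory.
Import numFieldNormedType.Exports.

Local Open Scope classical_set_scope.
Local Open Scope ring_scope.

(* C^k on a set U of interior points. Instead of the map x |-> 'd f x into the
   space of linear maps, all its evaluations x |-> 'd f x v are required to be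
   C^(k-1); this is the usual notion since V is only ever finite-dimensional. *)
Fixpoint Ck_on (R : realType) (V W : normedModType R) (k : nat) (U : set V)
    (f : V -> W) : Prop :=
  if k is k'.+1 then
    (forall x, U x -> differentiable f x) /\
    (forall v, Ck_on k' U (fun x => 'd f x v))
  else forall x, U x -> {for x, continuous f}.

(* Smoothness of a map defined on a subset (here, an embedded submanifold) S:
   locally it is the restriction of a C^oo map on an open set of the ambient
   space. The values of f outside S are irrelevant. *)
Definition smooth_map_on (R : realType) (V W : normedModType R) (S : set V)
    (f : V -> W) : Prop :=
  forall x, S x -> exists U : set V, exists g : V -> W,
    [/\ open U, U x, forall k, Ck_on k U g
      & forall y, S y -> U y -> f y = g y].

(* The Frechet differential at x of the restriction of f to a linear subspace A
   is df: f y = f x + df (y - x) + o(y - x) as y tends to x inside A. *)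
Definition has_diff_within (R : realType) (V W : normedModType R) (A : set V)
    (f : V -> W) (x : V) (df : V -> W) : Prop :=
  (fun y => `|y - x|^-1 *: (f y - f x - df (y - x))) @ within A x^' --> (0 : W).

Section GeneralizedStiefel.
Context {R : realType} {n p : nat}.
Variable M : 'M[R]_n.
Implicit Types X Y Z xi eta zeta : 'M[R]_(n, p).

Definition posdefmx : Prop := forall x : 'cV[R]_n,
  x != 0 -> 0 < (x^T *m M *m x) ord0 ord0.

Definition stiefel : set 'M[R]_(n, p) := [set X | X^T *m M *m X = 1%:M].

Definition tangent X : set 'M[R]_(n, p) :=
  [set Z | X^T *m M *m Z + Z^T *m M *m X = 0].

Definition tangent_bundle : set ('M[R]_(n, p) * 'M[R]_(n, p)) :=
  [set u | stiefel u.1 /\ tangent u.1 u.2].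

(* The triple (X, eta, xi) stands for eta, xi in the tangent space at X. *)
Definition tangent_bundle_sum :
    set ('M[R]_(n, p) * 'M[R]_(n, p) * 'M[R]_(n, p)) :=
  [set u | [/\ stiefel u.1.1, tangent u.1.1 u.1.2 & tangent u.1.1 u.2]].

(* The formula does not involve the foot point X. *)
Definition stiefel_metric X xi eta : R := \tr (xi^T *m M *m eta).

(* A map defined on the tangent bundle is a total function of the foot point X
   and the tangent vector Z, of which only the values on the bundle matter. *)
Definition is_retraction (Rt : 'M[R]_(n, p) -> 'M[R]_(n, p) -> 'M[R]_(n, p)) :
    Prop :=
  [/\ forall X Z, stiefel X -> tangent X Z -> stiefel (Rt X Z),
      smooth_map_on tangent_bundle (fun u => Rt u.1 u.2),
      forall X, stiefel X -> Rt X 0 = X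
    & forall X, stiefel X -> has_diff_within (tangent X) (Rt X) 0 id].

(* Tr X eta xi is the transport of xi along eta, both tangent at X; as an element
   of the tangent bundle it is the pair (Rt X eta, Tr X eta xi), where Rt is the
   associated retraction. *)
Definition is_vector_transport
    (Rt : 'M[R]_(n, p) -> 'M[R]_(n, p) -> 'M[R]_(n, p))
    (Tr : 'M[R]_(n, p) -> 'M[R]_(n, p) -> 'M[R]_(n, p) -> 'M[R]_(n, p)) :
    Prop :=
  [/\ is_retraction Rt,
      smooth_map_on tangent_bundle_sum
        (fun u => (Rt u.1.1 u.1.2, Tr u.1.1 u.1.2 u.2)),
      forall X eta xi, stiefel X -> tangent X eta -> tangent X xi ->
        tangent (Rt X eta) (Tr X eta xi),
      forall X xi, stiefel X -> tangent X xi -> Tr X 0 xi = xi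
    & forall X (a b : R) eta xi zeta,
        stiefel X -> tangent X eta -> tangent X xi -> tangent X zeta ->
        Tr X eta (a *: xi + b *: zeta) = a *: Tr X eta xi + b *: Tr X eta zeta].

Definition is_isometric_transport
    (Rt : 'M[R]_(n, p) -> 'M[R]_(n, p) -> 'M[R]_(n, p))
    (Tr : 'M[R]_(n, p) -> 'M[R]_(n, p) -> 'M[R]_(n, p) -> 'M[R]_(n, p)) :
    Prop :=
  forall X Y Z, stiefel X -> tangent X Y -> tangent X Z ->
    stiefel_metric (Rt X Z) (Tr X Z Y) (Tr X Z Y) = stiefel_metric X Y Y.

Definition cayley_P X : 'M[R]_n := 1%:M - 2^-1 *: (X *m X^T *m M).

Definition cayley_W X Z : 'M[R]_n :=
  cayley_P X *m Z *m X^T - X *m Z^T *m (cayley_P X)^T.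

Definition cayley_denom X Z : 'M[R]_n := 1%:M - 2^-1 *: (cayley_W X Z *m M).

Definition cayley_num X Z : 'M[R]_n := 1%:M + 2^-1 *: (cayley_W X Z *m M).

Definition cayley_retraction X Z : 'M[R]_(n, p) :=
  invmx (cayley_denom X Z) *m cayley_num X Z *m X.

Definition cayley_transport X Z Y : 'M[R]_(n, p) :=
  invmx (cayley_denom X Z) *m cayley_num X Z *m Y.

End GeneralizedStiefel.

(* Main.v *)
Require Import Defs.
From HB Require Import structures.
From mathcomp Require Import all_boot all_order all_fingroup all_algebra.
From mathcomp Require Import all_classical all_reals all_analysis.

Set Implicit Arguments.
Unset Strict Implicit.
Unset Printing Implicit Defensive.

Import Order.TTheory GRing.Theory Num.Theory.
Import numFieldNormedType.Exports.

Local Open Scope classical_set_scope.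
Local Open Scope ring_scope.

(** Everything follows from the properties of one matrix, the Cayley transform
    C = (1 - K)^-1 (1 + K) of K = W_Z M / 2: both the retraction and the
    transport are multiplication by C, applied to X and to Y respectively.

    Since W_Z is skew-symmetric, K is skew-adjoint for the inner product defined
    by M, that is K^T M = - M K. Hence 1 - K is injective (a fixed vector v of K
    satisfies v^T M v = - v^T M v), and C is an isometry of that inner product
    ([cayley_transform_isometry]), as for the classical Cayley map from
    skew-symmetric to orthogonal matrices. Preservation of St_M, tangency of the
    transported vectors and invariance of the metric are the instances
    (C A)^T M (C B) = A^T M B of this isometry ([cayley_mx_pairing]).

    W_Z is skew-symmetric for arbitrary matrices X and Z, so 1 - K never
    degenerates and C is a C^oo function of (X, Z) on the whole ambient space:
    its entries are rational functions with a nonvanishing denominator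
    ([Ck_on_cayley_mx]). Behind this is the stability of C^k maps under sums,
    products, reciprocals and linear maps, applied entry by entry.

    That the retraction is the identity to first order rests on W_Z M X = Z for
    tangent Z ([cayley_W_tangent]), which gives the exact relation
    C X - X = (C Z + Z) / 2 ([cayley_midpoint]). The error C X - X - Z is
    therefore ((C - 1) / 2) Z, which is o(Z) because C tends to 1 as Z tends
    to 0. *)

(** * Calculus of C^k maps *)

Section Differentiation.
Context {R : realType} {V W : normedModType R}.

(** The differential is chosen among the linear maps that satisfy its defining
    expansion, so its locality has to go through uniqueness. *)
Lemma near_eq_diff (f g : V -> W) (x : V) :
  (\forall y \near x, f y = g y) -> differentiable f x ->
  differentiable g x /\ 'd g x = 'd f x :> (V -> W).
Proof.
move=> fg df; have [dfc fE] := (diff_locallyP x f).1 df.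
have gE : g \o shift x = cst (g x) + 'd f x +o_ 0 id.
  apply/eqaddoP => e e0; have /eqaddoP /(_ e e0) := fE.
  have fgx : f x = g x := nbhs_singleton fg.
  move: fg; rewrite (near_shift 0) subr0; apply: filterS2 => h.
  rewrite ![(_ + _ : _ -> _) _]/(_ + _) ![(- _ : _ -> _) _]/(- _) /=.
  by rewrite /cst /= => ->; rewrite fgx.
have dgE := diff_unique dfc gE.
by split=> //; apply/diff_locallyP; rewrite dgE.
Qed.

End Differentiation.

Section Smoothness.
Context {R : realType} {V : normedModType R}.
Variable U : set V.
Hypothesis Uo : open U.

(** The C^k condition iterates differentials, whose computation rules are valid
    on U only: every closure property below is proved by replacing, on U, the
    differential by its closed formula. Openness of U is what makes this
    legitimate. *)
Lemma Ck_on_eq (W : normedModType R) k (f g : V -> W) :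
  (forall x, U x -> f x = g x) -> Ck_on k U f -> Ck_on k U g.
Proof.
have near_fg (f' g' : V -> W) x : (forall y, U y -> f' y = g' y) -> U x ->
    \forall y \near x, f' y = g' y.
  by move=> fg Ux; apply: filterS (open_nbhs_nbhs (conj Uo Ux)).
elim: k f g => [|k IH] f g fg /=.
  move=> fc x Ux; suff : g @ x --> f x by rewrite fg.
  by apply: cvg_trans (fc _ Ux); apply/near_eq_cvg/near_fg.
move=> [df dfC]; split=> [x Ux|v].
  by case: (near_eq_diff (near_fg _ _ _ fg Ux) (df _ Ux)).
apply: IH (dfC v) => x Ux.
by case: (near_eq_diff (near_fg _ _ _ fg Ux) (df _ Ux)) => _ ->.
Qed.

Lemma Ck_on_le (W : normedModType R) k (f : V -> W) :
  Ck_on k.+1 U f -> Ck_on k U f.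
Proof.
elim: k f => [|k IH] f [df dfC]; last by split=> // v; apply/IH/dfC.
by move=> x Ux; apply/differentiable_continuous/df.
Qed.

Lemma Ck_on_cst (W : normedModType R) k (c : W) : Ck_on k U (cst c).
Proof.
elim: k c => [|k IH] c; first by move=> x _; exact: cvg_cst.
split=> [x _|v]; first exact: differentiable_cst.
apply: Ck_on_eq (IH 0) => x _.
by rewrite diff_cst.
Qed.

Lemma Ck_on_linear (W : normedModType R) k (f : V -> W) :
  linear f -> continuous f -> Ck_on k U f.
Proof.
move=> f_lin f_cont.
pose fL : {linear V -> W} :=
  HB.pack f (GRing.isLinear.Build _ _ _ _ _ f_lin).
have dfE x : 'd f x = f :> (V -> W) by exact: (@diff_lin _ _ _ fL).
case: k => [|k]; first by move=> x _; exact: f_cont.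
split=> [x _|v]; first exact: (@linear_differentiable _ _ _ fL).
by apply: Ck_on_eq (Ck_on_cst k (f v)) => x _; rewrite dfE.
Qed.

Lemma Ck_onD (W : normedModType R) k (f g : V -> W) :
  Ck_on k U f -> Ck_on k U g -> Ck_on k U (fun x => f x + g x).
Proof.
elim: k f g => [|k IH] f g.
  by move=> fc gc x Ux; apply: cvgD; [exact: fc|exact: gc].
move=> [df dfC] [dg dgC]; split=> [x Ux|v].
  by apply: differentiableD; auto.
apply: Ck_on_eq (IH _ _ (dfC v) (dgC v)) => x Ux.
by rewrite diffD//; auto.
Qed.

Lemma Ck_on_sum (W : normedModType R) (I : Type) (r : seq I) (P : pred I) k
    (f : I -> V -> W) :
  (forall i, Ck_on k U (f i)) -> Ck_on k U (fun x => \sum_(i <- r | P i) f i x).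
Proof.
move=> fC; elim: r => [|i r IH].
  by apply: Ck_on_eq (Ck_on_cst k 0) => x _; rewrite big_nil.
case Pi: (P i).
  by apply: Ck_on_eq (Ck_onD (fC i) IH) => x _; rewrite big_cons Pi.
by apply: Ck_on_eq IH => x _; rewrite big_cons Pi.
Qed.

Lemma Ck_on_linear_comp (W1 W2 : normedModType R) k (g : W1 -> W2)
    (f : V -> W1) : linear g -> continuous g ->
  Ck_on k U f -> Ck_on k U (fun x => g (f x)).
Proof.
move=> g_lin g_cont.
pose gL : {linear W1 -> W2} :=
  HB.pack g (GRing.isLinear.Build _ _ _ _ _ g_lin).
have dgE y : 'd g y = g :> (W1 -> W2) by exact: (@diff_lin _ _ _ gL).
have dg y : differentiable g y by exact: (@linear_differentiable _ _ _ gL).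
elim: k f => [|k IH] f.
  by move=> fc x Ux; apply: continuous_comp; [exact: fc|exact: g_cont].
move=> [df dfC]; split=> [x Ux|v].
  by apply: differentiable_comp; [exact: df|exact: dg].
apply: Ck_on_eq (IH _ (dfC v)) => x Ux.
by rewrite (diff_comp (df _ Ux) (dg _)) dgE.
Qed.

Lemma Ck_on_pair (W1 W2 : normedModType R) k (f : V -> W1) (g : V -> W2) :
  Ck_on k U f -> Ck_on k U g -> Ck_on k U (fun x => (f x, g x)).
Proof.
elim: k f g => [|k IH] f g.
  by move=> fc gc x Ux; apply: cvg_pair; [exact: fc|exact: gc].
move=> [df dfC] [dg dgC]; split=> [x Ux|v].
  by apply: differentiable_pair; auto.
by apply: Ck_on_eq (IH _ _ (dfC v) (dgC v)) => x Ux; rewrite diff_pair; auto.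
Qed.

(** By the Leibniz rule the differential contains f and g themselves,
    undifferentiated, hence the descent of the factors from C^(k+1) to C^k in
    the induction. *)
Lemma Ck_onM k (f g : V -> R) :
  Ck_on k U f -> Ck_on k U g -> Ck_on k U (fun x => f x * g x).
Proof.
elim: k f g => [|k IH] f g.
  by move=> fc gc x Ux; apply: cvgM; [exact: fc|exact: gc].
move=> fC gC; have [[df dfC] [dg dgC]] := (fC, gC).
split=> [x Ux|v]; first by apply: differentiableM; auto.
have H := Ck_onD (IH _ _ (Ck_on_le fC) (dgC v))
                       (IH _ _ (Ck_on_le gC) (dfC v)).
by apply: Ck_on_eq H => x Ux; rewrite diffM; auto.
Qed.

Lemma Ck_on_prod (I : Type) (r : seq I) k (f : I -> V -> R) :
  (forall i, Ck_on k U (f i)) -> Ck_on k U (fun x => \prod_(i <- r) f i x).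
Proof.
move=> fC; elim: r => [|i r IH].
  by apply: Ck_on_eq (@Ck_on_cst R k 1) => x _; rewrite big_nil.
by apply: Ck_on_eq (Ck_onM (fC i) IH) => x _; rewrite big_cons.
Qed.

(** The differential - f^-2 df contains f^-1, to which the induction hypothesis
    applies. *)
Lemma Ck_onV k (f : V -> R) : (forall x, U x -> f x != 0) ->
  Ck_on k U f -> Ck_on k U (fun x => (f x)^-1).
Proof.
move=> f0; elim: k => [|k IH].
  by move=> fc x Ux; apply: cvgV; [exact: f0|exact: fc].
move=> fC; have [df dfC] := fC.
split=> [x Ux|v]; first by apply: differentiableV; auto.
have fVC := IH (Ck_on_le fC).
apply: Ck_on_eq (Ck_onM (@Ck_on_cst R k (-1))
  (Ck_onM (Ck_onM fVC fVC) (dfC v))) => x Ux.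
rewrite diffV; [|exact: df|exact: f0].
by rewrite /cst /= mulN1r -exprVn expr2 scaleNr.
Qed.

(** Entries are continuous linear functions of a matrix; conversely a matrix is
    the sum of its entries times the elementary matrices. *)
Lemma Ck_on_mxP k m n (F : V -> 'M[R]_(m, n)) :
  Ck_on k U F <-> forall i j, Ck_on k U (fun x => F x i j).
Proof.
split=> [FC i j|FC].
  apply: (Ck_on_linear_comp (g := fun A : 'M[R]_(m, n) => A i j)) FC.
    by move=> c A B; rewrite !mxE.
  exact: coord_continuous.
have H : Ck_on k U (fun x => \sum_i \sum_j F x i j *: delta_mx i j).
  do 2 apply: Ck_on_sum => ?.
  apply: (Ck_on_linear_comp (g := fun c : R => c *: delta_mx _ _)) (FC _ _).
    by move=> c a b; rewrite scalerDl scalerA.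
  exact: scalel_continuous.
by apply: Ck_on_eq H => x _; rewrite -matrix_sum_delta.
Qed.

Lemma Ck_onZ k (W : normedModType R) (c : R) (f : V -> W) :
  Ck_on k U f -> Ck_on k U (fun x => c *: f x).
Proof.
apply: Ck_on_linear_comp; last exact: scaler_continuous.
by move=> a u v; rewrite scalerDr !scalerA mulrC.
Qed.

Lemma Ck_onB k (W : normedModType R) (f g : V -> W) :
  Ck_on k U f -> Ck_on k U g -> Ck_on k U (fun x => f x - g x).
Proof.
move=> fC /(Ck_onZ (-1)) gC.
by apply: Ck_on_eq (Ck_onD fC gC) => x _; rewrite scaleN1r.
Qed.

Lemma Ck_on_tr k m n (F : V -> 'M[R]_(m, n)) :
  Ck_on k U F -> Ck_on k U (fun x => (F x)^T).
Proof.
move=> /Ck_on_mxP FC; apply/Ck_on_mxP => i j.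
by apply: Ck_on_eq (FC j i) => x _; rewrite mxE.
Qed.

Lemma Ck_on_mulmx k m n p (F : V -> 'M[R]_(m, n)) (G : V -> 'M[R]_(n, p)) :
  Ck_on k U F -> Ck_on k U G -> Ck_on k U (fun x => F x *m G x).
Proof.
move=> /Ck_on_mxP FC /Ck_on_mxP GC; apply/Ck_on_mxP => i j.
have H : Ck_on k U (fun x => \sum_l F x i l * G x l j : R).
  by apply: Ck_on_sum => l; apply: Ck_onM.
by apply: Ck_on_eq H => x _; rewrite mxE.
Qed.

Lemma Ck_on_det k n (F : V -> 'M[R]_n) :
  Ck_on k U F -> Ck_on k U (fun x => \det (F x)).
Proof.
move=> /Ck_on_mxP FC; apply: Ck_on_sum => s.
by apply: Ck_onM; [exact: Ck_on_cst|exact: Ck_on_prod].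
Qed.

(** Cramer's rule: the entries of the inverse are cofactors divided by the
    determinant. *)
Lemma Ck_on_invmx k n (F : V -> 'M[R]_n) :
  (forall x, U x -> F x \in unitmx) ->
  Ck_on k U F -> Ck_on k U (fun x => invmx (F x)).
Proof.
move=> Fu FC.
have FijC := (Ck_on_mxP _ _).1 FC.
apply/Ck_on_mxP => i j.
have minorC : Ck_on k U (fun x => row' j (col' i (F x))).
  apply/Ck_on_mxP => a b.
  by apply: Ck_on_eq (FijC (lift j a) (lift i b)) => x _; rewrite !mxE.
have cofC : Ck_on k U (fun x => cofactor (F x) j i).
  by apply: Ck_onM; [exact: Ck_on_cst|exact: Ck_on_det].
have detV : Ck_on k U (fun x => (\det (F x))^-1).
  by apply: Ck_onV (Ck_on_det FC) => x /Fu; rewrite unitmxE unitfE.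
apply: Ck_on_eq (Ck_onM detV cofC) => x Ux.
by rewrite /invmx Fu // !mxE.
Qed.

End Smoothness.

Lemma smooth_map_onT (R : realType) (V W : normedModType R) (S : set V)
    (f : V -> W) : (forall k, Ck_on k setT f) -> smooth_map_on S f.
Proof. by move=> fC x _; exists setT, f; split=> //; exact: openT. Qed.

Lemma Ck_on_fst (R : realType) (V W : normedModType R) k :
  Ck_on k [set: V * W] fst.
Proof. by apply: Ck_on_linear => [||u]; [exact: openT| |exact: cvg_fst]. Qed.

Lemma Ck_on_snd (R : realType) (V W : normedModType R) k :
  Ck_on k [set: V * W] snd.
Proof. by apply: Ck_on_linear => [||u]; [exact: openT| |exact: cvg_snd]. Qed.

(** * Products of null and bounded matrices *)

Lemma ler_mx_entry {R : realType} m n (A : 'M[R]_(m, n)) i j : `|A i j| <= `|A|.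
Proof.
rewrite [leRHS]/Num.norm /= mx_normrE.
by apply/bigmax_geP; right; exists (i, j).
Qed.

(** The norm is the maximum of the absolute values of the entries, which is
    submultiplicative only up to the number of terms in an entry of the
    product. *)
Lemma mulmx_norm_le {R : realType} m n p (A : 'M[R]_(m, n)) (B : 'M[R]_(n, p)) :
  `|A *m B| <= n%:R * (`|A| * `|B|).
Proof.
rewrite [leLHS]/Num.norm /= mx_normrE; apply/bigmax_leP; split=> [|[i j] _ /=].
  by rewrite !mulr_ge0.
rewrite mxE (le_trans (ler_norm_sum _ _ _))//.
rewrite mulr_natl -[leRHS](_ : \sum_(l < n) `|A| * `|B| = _); last first.
  by rewrite sumr_const card_ord.
by apply: ler_sum => l _; rewrite normrM ler_pM// ler_mx_entry.
Qed.

Lemma cvg0_mulmx_bounded {R : realType} {T : Type} {F : set_system T}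
    {FF : Filter F} m n p (A : T -> 'M[R]_(m, n)) (B : T -> 'M[R]_(n, p)) :
  A t @[t --> F] --> (0 : 'M[R]_(m, n)) ->
  (\forall t \near F, `|B t| <= 1) ->
  A t *m B t @[t --> F] --> (0 : 'M[R]_(m, p)).
Proof.
move=> A0 B1; apply/norm_cvg0P.
have nA0 : n%:R * `|A t| @[t --> F] --> (0 : R).
  by rewrite -(mulr0 n%:R); apply: cvgMl_tmp; exact/norm_cvg0P.
apply: (squeeze_cvgr (f := cst 0) _ _ nA0); last exact: cvg_cst.
move: B1; apply: filterS => t B1; rewrite normr_ge0 /=.
by rewrite (le_trans (mulmx_norm_le _ _))// ler_wpM2l// ler_piMr.
Qed.

(** * The Cayley transform of a skew-adjoint matrix *)

Section CayleyTransform.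
Context {R : realType} {n : nat}.
Variables M K : 'M[R]_n.
Hypotheses (M_posdef : posdefmx M) (MK : K^T *m M = - (M *m K)).

(** If K v = v then v^T M v = (K v)^T M v = - v^T M (K v) = - v^T M v vanishes,
    and v = 0 by positive definiteness. *)
Lemma one_sub_skew_unit : 1%:M - K \in unitmx.
Proof.
rewrite -unitmx_tr unitmxE unitfE; apply/negP => /eqP /eqP /det0P [v v0].
rewrite linearB /= trmx1 mulmxBr mulmx1 => /subr0_eq vK.
have Kv : v^T = K *m v^T by rewrite [in LHS]vK trmx_mul trmxK.
have vMv : v *m M *m v^T = - (v *m M *m v^T).
  rewrite {1}vK -[_ *m K^T *m M]mulmxA MK mulmxN mulNmx.
  by rewrite !mulmxA -[_ *m K *m _]mulmxA -Kv.
have vT0 : v^T != 0 by rewrite -(inj_eq trmx_inj) trmxK trmx0.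
have := M_posdef vT0; rewrite trmxK.
have /matrixP /(_ ord0 ord0) := vMv; rewrite [RHS]mxE => /eqP.
by rewrite -addr_eq0 -mulr2n mulrn_eq0 /= => /eqP ->; rewrite ltxx.
Qed.

Definition cayley_transform : 'M[R]_n := invmx (1%:M - K) *m (1%:M + K).

Lemma cayley_transform_comm : cayley_transform = (1%:M + K) *m invmx (1%:M - K).
Proof.
have comm : (1%:M - K) *m (1%:M + K) = (1%:M + K) *m (1%:M - K).
  by rewrite mulmxBl mulmxBr mul1mx mulmx1 mulmxDr mulmxDl mulmx1 mul1mx.
apply: (can_inj (mulKmx one_sub_skew_unit)).
rewrite /cayley_transform mulKVmx ?one_sub_skew_unit// mulmxA comm.
by rewrite mulmxK ?one_sub_skew_unit.
Qed.

(** Moving M across turns the transpose of 1 + K into 1 - K and conversely, so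
    that numerator and denominator cancel; one of the two copies of the
    transform must be written with its factors exchanged. *)
Lemma cayley_transform_isometry :
  cayley_transform^T *m M *m cayley_transform = M.
Proof.
have NM : (1%:M + K)^T *m M = M *m (1%:M - K).
  by rewrite linearD /= trmx1 mulmxDl mul1mx MK mulmxBr mulmx1.
have DM : (1%:M - K)^T *m M = M *m (1%:M + K).
  by rewrite linearB /= trmx1 mulmxBl mul1mx MK opprK mulmxDr mulmx1.
rewrite {1}cayley_transform_comm trmx_mul -(mulmxA _ _ M) NM /cayley_transform.
rewrite !mulmxA mulmxK ?one_sub_skew_unit// -mulmxA -DM trmx_inv mulKmx//.
by rewrite unitmx_tr one_sub_skew_unit.
Qed.

End CayleyTransform.

(** * The Cayley matrix of a tangent vector *)

Section GeneralizedStiefelCayley.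
Context {R : realType} {n p : nat}.
Variable M : 'M[R]_n.
Hypotheses (M_sym : M^T = M) (M_posdef : posdefmx M).
Implicit Types X Y Z : 'M[R]_(n, p).

Lemma cayley_W_skew X Z : (cayley_W M X Z)^T = - cayley_W M X Z.
Proof.
by rewrite /cayley_W linearB /= !trmx_mul !trmxK opprB !mulmxA.
Qed.

Lemma cayley_WM_skew X Z (K := 2^-1 *: (cayley_W M X Z *m M)) :
  K^T *m M = - (M *m K).
Proof.
rewrite /K linearZ /= trmx_mul M_sym cayley_W_skew mulmxN.
by rewrite -scalemxAl -scalemxAr mulNmx scalerN mulmxA.
Qed.

Lemma cayley_denom_unit X Z : cayley_denom M X Z \in unitmx.
Proof. exact: one_sub_skew_unit (cayley_WM_skew X Z). Qed.

(** The common left factor of the Cayley retraction and of the transport. *)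
Definition cayley_mx X Z := cayley_transform (2^-1 *: (cayley_W M X Z *m M)).

Lemma cayley_mx_isometry X Z (C := cayley_mx X Z) : C^T *m M *m C = M.
Proof. exact: cayley_transform_isometry (cayley_WM_skew X Z). Qed.

Lemma cayley_mx_pairing X Z q r (A : 'M[R]_(n, q)) (B : 'M[R]_(n, r))
    (C := cayley_mx X Z) : (C *m A)^T *m M *m (C *m B) = A^T *m M *m B.
Proof.
rewrite -[in RHS](cayley_mx_isometry X Z) trmx_mul -/C.
by rewrite !mulmxA.
Qed.

(** Under X^T M X = 1 the product is Z - X (X^T M Z + Z^T M X) / 2, and the
    bracket is the tangency condition. This is where the factor 1/2 of the
    projector P_X matters. *)
Lemma cayley_W_tangent X Z : stiefel M X -> tangent M X Z ->
  cayley_W M X Z *m (M *m X) = Z.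
Proof.
rewrite /stiefel /tangent /= => XMX XMZ.
have MXP : (cayley_P M X)^T *m (M *m X) = 2^-1 *: (M *m X).
  rewrite /cayley_P linearB linearZ /= trmx1 !trmx_mul trmxK M_sym.
  rewrite mulmxBl mul1mx -scalemxAl -!mulmxA [X^T *m _]mulmxA XMX mulmx1.
  by rewrite -{1}[M *m X]scale1r -scalerBl {1}[1](splitr 1) mul1r addrK.
rewrite /cayley_W mulmxBl -!mulmxA MXP -scalemxAr.
rewrite [X^T *m _]mulmxA XMX mulmx1 /cayley_P mulmxBl mul1mx -scalemxAl.
rewrite -scalemxAr -addrA -opprD -scalerDr -!mulmxA -mulmxDr !mulmxA XMZ.
by rewrite mulmx0 scaler0 subr0.
Qed.

Lemma Ck_on_cayley_mx (V : normedModType R) (U : set V) k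
    (X Z : V -> 'M[R]_(n, p)) : open U ->
  Ck_on k U X -> Ck_on k U Z -> Ck_on k U (fun x => cayley_mx (X x) (Z x)).
Proof.
move=> Uo XC ZC.
have PC : Ck_on k U (fun x => cayley_P M (X x)).
  apply: Ck_onB => //; first exact: Ck_on_cst.
  by apply/Ck_onZ/Ck_on_mulmx/Ck_on_cst => //; apply/Ck_on_mulmx/Ck_on_tr.
have WC : Ck_on k U (fun x => cayley_W M (X x) (Z x)).
  apply: Ck_onB => //; apply: Ck_on_mulmx => //; try exact: Ck_on_tr.
    exact: Ck_on_mulmx.
  by apply: Ck_on_mulmx => //; exact: Ck_on_tr.
have KC : Ck_on k U (fun x => 2^-1 *: (cayley_W M (X x) (Z x) *m M)).
  by apply/Ck_onZ/Ck_on_mulmx/Ck_on_cst.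
apply: Ck_on_mulmx => //.
  apply: Ck_on_invmx => //; first by move=> x _; exact: cayley_denom_unit.
  by apply: Ck_onB => //; exact: Ck_on_cst.
by apply: Ck_onD => //; exact: Ck_on_cst.
Qed.

(** With D = 1 - K, both sides become Z after multiplication by D: the left one
    is (1 + K) X - (1 - K) X = W_Z M X = Z, and the right one is
    ((1 + K) Z + (1 - K) Z) / 2 = Z. *)
Lemma cayley_midpoint X Z (C := cayley_mx X Z) : stiefel M X -> tangent M X Z ->
  C *m X - X = 2^-1 *: (C *m Z + Z).
Proof.
move=> XMX XMZ; have Du := cayley_denom_unit X Z.
have DC : cayley_denom M X Z *m C = cayley_num M X Z.
  by rewrite /C /cayley_mx /cayley_transform mulKVmx.
apply: (can_inj (mulKmx Du)).
rewrite -scalemxAr mulmxBr mulmxDr !(mulmxA _ C) DC -mulmxBl -mulmxDl.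
have -> : cayley_num M X Z - cayley_denom M X Z = cayley_W M X Z *m M.
  rewrite /cayley_num /cayley_denom opprB addrC addrA subrK.
  by rewrite -scalerDl -[2^-1]mul1r -splitr scale1r.
have -> : cayley_num M X Z + cayley_denom M X Z = 2 *: 1%:M.
  by rewrite addrACA subrr addr0 scaler_nat mulr2n.
by rewrite -mulmxA cayley_W_tangent// -scalemxAl mul1mx scalerA mulVf ?scale1r.
Qed.

Lemma cayley_mx0 X : cayley_mx X 0 = 1%:M.
Proof.
have -> : cayley_mx X 0 = invmx 1%:M *m 1%:M.
  rewrite /cayley_mx /cayley_transform /cayley_W trmx0.
  by rewrite !(mulmx0, mul0mx, subr0, scaler0, addr0).
by rewrite invmx1 mulmx1.
Qed.

Lemma cayley_mx_continuous X :
  {for 0, continuous (fun Z : 'M[R]_(n, p) => cayley_mx X Z)}.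
Proof.
have C0 : Ck_on 0 setT (fun Z : 'M[R]_(n, p) => cayley_mx X Z).
  apply: Ck_on_cayley_mx => //; first exact: openT.
    by apply: Ck_on_cst; exact: openT.
  by apply: Ck_on_linear => [|//|Z]; [exact: openT|exact: cvg_id].
exact: C0.
Qed.

(** By [cayley_midpoint] the remainder at Z is ((C - 1) / 2) Z, whose
    quotient by the norm of Z is a null matrix times a bounded one. *)
Lemma cayley_has_diff X : stiefel M X ->
  has_diff_within (tangent M X) (cayley_retraction M X) 0 id.
Proof.
move=> XMX; rewrite /has_diff_within.
set F := within _ _; have FF : Filter F by exact: within_filter.
have A0 : 2^-1 *: (cayley_mx X Z - 1%:M) @[Z --> F] --> (0 : 'M[R]_n).
  rewrite -(scaler0 _ 2^-1) -(subrr (1%:M : 'M[R]_n)).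
  apply: cvgZl_tmp; apply: cvgB; last exact: cvg_cst.
  rewrite -(cayley_mx0 X); apply: cvg_trans (@cayley_mx_continuous X).
  apply: cvg_app; apply: cvg_trans (cvg_within _) _.
  exact: nbhs_dnbhs.
have B1 : \forall Z \near F, `| `|Z|^-1 *: Z| <= 1.
  apply: nearW => Z; rewrite normrZ normfV normr_id.
  have [->|Z0] := eqVneq Z 0; first by rewrite normr0 mulr0.
  by rewrite mulVf ?normr_eq0.
apply: cvg_trans (cvg0_mulmx_bounded A0 B1); apply: near_eq_cvg.
apply: filterS (withinT _ _) => Z ZX; rewrite !subr0.
rewrite -[cayley_retraction M X Z]/(cayley_mx X Z *m X).
rewrite -[cayley_retraction M X 0]/(cayley_mx X 0 *m X).
rewrite cayley_mx0 mul1mx cayley_midpoint// -scalemxAr; congr (_ *: _).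
have ZE : Z = 2^-1 *: (Z + Z).
  by rewrite scalerDr -scalerDl -[2^-1]mul1r -splitr scale1r.
rewrite [X in _ = _ - X]ZE -scalerBr opprD addrA addrK.
by rewrite -scalemxAl mulmxBl mul1mx.
Qed.

Lemma cayley_mx_stiefel X Z : stiefel M X -> stiefel M (cayley_mx X Z *m X).
Proof. by rewrite /stiefel /= cayley_mx_pairing. Qed.

Lemma cayley_mx_tangent X Y Z : tangent M X Y ->
  tangent M (cayley_mx X Z *m X) (cayley_mx X Z *m Y).
Proof. by rewrite /tangent /= !cayley_mx_pairing. Qed.

Lemma cayley_is_retraction : is_retraction M (@cayley_retraction R n p M).
Proof.
split=> [X Z XMX _||X _|X XMX].
- exact: cayley_mx_stiefel.
- apply: smooth_map_onT => k; apply: Ck_on_mulmx; first exact: openT.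
    by apply: Ck_on_cayley_mx; [exact: openT|exact: Ck_on_fst|exact: Ck_on_snd].
  exact: Ck_on_fst.
- by rewrite -[LHS]/(cayley_mx X 0 *m X) cayley_mx0 mul1mx.
- exact: cayley_has_diff.
Qed.

Lemma cayley_is_vector_transport :
  is_vector_transport M (@cayley_retraction R n p M)
    (@cayley_transport R n p M).
Proof.
split=> [||X Z Y _ _ XMY|X Y _ _|X a b Z Y Y' _ _ _ _].
- exact: cayley_is_retraction.
- apply: smooth_map_onT => k; pose E := 'M[R]_(n, p).
  have To : open [set: E * E * E] by exact: openT.
  have XC : Ck_on k setT (fun u : E * E * E => u.1.1).
    by apply: Ck_on_linear => // u; apply: continuous_comp; exact: cvg_fst.
  have ZC : Ck_on k setT (fun u : E * E * E => u.1.2).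
    apply: Ck_on_linear => // u.
    by apply: continuous_comp; [exact: cvg_fst|exact: cvg_snd].
  have CC := Ck_on_cayley_mx To XC ZC.
  apply: Ck_on_pair => //; apply: Ck_on_mulmx => //; exact: Ck_on_snd.
- exact: cayley_mx_tangent.
- by rewrite -[LHS]/(cayley_mx X 0 *m Y) cayley_mx0 mul1mx.
- by rewrite /cayley_transport mulmxDr -!scalemxAr.
Qed.

Lemma cayley_is_isometric :
  is_isometric_transport M (@cayley_retraction R n p M)
    (@cayley_transport R n p M).
Proof.
by move=> X Y Z _ _ _; congr (\tr _); exact: cayley_mx_pairing.
Qed.

End GeneralizedStiefelCayley.

(* The first conjunct says that the inverse matrix in the Cayley formula exists:
   invmx returns its argument on singular matrices. *)
Theorem lemma3p4 (R : realType) (n p : nat) (M : 'M[R]_n)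
    (M_sym : M^T = M) (M_posdef : posdefmx M)
    (p_ge1 : (1 <= p)%N) (p_le_n : (p <= n)%N) :
  [/\ forall X Z : 'M[R]_(n, p), stiefel M X -> tangent M X Z ->
        cayley_denom M X Z \in unitmx,
      is_vector_transport M (@cayley_retraction R n p M)
        (@cayley_transport R n p M)
    & is_isometric_transport M (@cayley_retraction R n p M)
        (@cayley_transport R n p M)].
Proof.
split; first by move=> X Z _ _; exact: cayley_denom_unit.
- exact: cayley_is_vector_transport.
- exact: cayley_is_isometric.
Qed.
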